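(* Let $T$ be a tree with $4k$ vertices for some $k\in\mathbb{N}$. If $T$ is not the path $P_4$, then $T$ is $\mathbb{Z}_2^2$-cordial.
   Context: $\mathbb{N}=\mathbb{Z}_{\ge0}$ (the tree with $0$ vertices is allowed). $\mathbb{Z}_2^2=\mathbb{Z}_2\times\mathbb{Z}_2$ is the Klein four-group; $P_4$ is the path on 4 vertices. For an abelian group $A$ and a graph $G=(V,E)$, a vertex labeling $\ell:V\to A$ induces an edge labeling $\ell(\{v_1,v_2\})=\ell(v_1)+\ell(v_2)$. Let $f_V(a)=|\{v\in V:\ell(v)=a\}|$ and $f_E(a)=|\{e\in E:\ell(e)=a\}|$. The labeling is $A$-cordial if $|f_V(a_1)-f_V(a_2)|\le 1$ and $|f_E(a_1)-f_E(a_2)|\le 1$ for all $a_1,a_2\in A$; $G$ is $A$-cordial if it admits an $A$-cordial labeling. *)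

(* Defs.v *)
From mathcomp Require Import all_boot all_order all_algebra.
Set Implicit Arguments. Unset Strict Implicit. Unset Printing Implicit Defensive.
Import GRing.Theory.

Definition simple_graph (T : finType) (e : rel T) : Prop :=
  symmetric e /\ irreflexive e.

Definition connected (T : finType) (e : rel T) : Prop :=
  forall x y : T, connect e x y.

Definition acyclic (T : finType) (e : rel T) : Prop :=
  forall s : seq T, uniq s -> 3 <= size s -> ~~ cycle e s.

(* A tree: a connected acyclic simple graph (the empty tree is allowed). *)
Definition is_tree (T : finType) (e : rel T) : Prop :=
  [/\ simple_graph e, connected e & acyclic e].

Definition edges (T : finType) (e : rel T) : {set {set T}} :=
  [set [set x; y] | x in T, y in T & e x y].

Definition P4_adj (i j : 'I_4) : bool := (i.+1 == j :> nat) || (j.+1 == i :> nat).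

Definition is_P4 (T : finType) (e : rel T) : Prop :=
  exists f : T -> 'I_4, bijective f /\ forall x y, e x y = P4_adj (f x) (f y).

Definition fV (T : finType) (A : zmodType) (l : T -> A) (a : A) : nat :=
  #|[set v : T | l v == a]|.

Definition fE (T : finType) (e : rel T) (A : zmodType) (l : T -> A) (a : A) : nat :=
  #|[set [set x; y] | x in T, y in T & e x y && (l x + l y == a)%R]|.

Definition cordial_labeling (T : finType) (e : rel T) (A : zmodType) (l : T -> A) : Prop :=
  forall a1 a2 : A,
    (`|fV l a1 - fV l a2| <= 1)%N /\
    (`|fE e l a1 - fE e l a2| <= 1)%N.

Definition cordial (T : finType) (e : rel T) (A : zmodType) : Prop :=
  exists l : T -> A, cordial_labeling e l.

Definition Klein4 : zmodType := ('Z_2 * 'Z_2)%type.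

(* Main.v *)
(** Labels are bit pairs under xor. Call a labelling of a tree on [4 k] vertices balanced with rare label [d] if every vertex label occurs [k] times and every edge label [k] times, except [d], which occurs [k - 1] times. Balanced labellings are extended four vertices at a time, the rare label being allowed to change.

If the tree has four leaves, remove them: whatever the labels of their neighbours are, the four leaves can be relabelled. Otherwise the tree is a spider with at most three legs, and from 12 vertices on some leg contains a pendant path with four vertices; removing it works as long as [d] is nonzero, and the new rare label can again be made nonzero. So the induction carries the invariant that [d] is nonzero or the tree has four leaves. It starts with the trees on 8 vertices, which are enumerated by their parent lists; on 4 vertices only the star remains once [P_4] is excluded. *)
Require Import Defs.
From mathcomp Require Import all_boot all_order all_algebra.
From mathcomp Require Import zify ring.

Set Implicit Arguments. Unset Strict Implicit. Unset Printing Implicit Defensive.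

(** * Bit-pair labels and the finite checks on four and on eight vertices *)

Definition lab := (bool * bool)%type.

Definition addl (a b : lab) : lab := (a.1 (+) b.1, a.2 (+) b.2).

Definition labs : seq lab :=
  [:: (false, false); (false, true); (true, false); (true, true)].

Lemma addlC a b : addl a b = addl b a.
Proof. by rewrite /addl addbC [a.2 (+) _]addbC. Qed.

Lemma mem_labs a : a \in labs.
Proof. by case: a => [[] []]. Qed.

(* Unlike [has], this stops at the first hit under call-by-value evaluation. *)
Fixpoint search (A : Type) (P : pred A) (s : seq A) :=
  if s is x :: s' then if P x then true else search P s' else false.

Lemma searchE (A : Type) (P : pred A) s : search P s = has P s.
Proof. by elim: s => //= x s ->. Qed.

(* [B] labels four new vertices and [P] lists the labels of the vertices they are attached to; the rare edge label changes from [d] to [d']. *)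
Definition extends d (P B : seq lab) d' :=
  (size B == 4) && all (fun a =>
    (count_mem a B == 1) &&
    (count_mem a [seq addl ab.1 ab.2 | ab <- zip B P] + (a == d') == 1 + (a == d)))
  labs.

(** A finite check. There is no freedom in [d']: the labels in [B] sum to 0, so summing the new edge
    labels forces [d' = d + a1 + a2 + a3 + a4], which may well be 0. *)
Lemma extends_leaves d a1 a2 a3 a4 : exists B d', extends d [:: a1; a2; a3; a4] B d'.
Proof.
have H : all (fun d => all (fun a1 => all (fun a2 => all (fun a3 => all (fun a4 =>
  search (fun B => search (extends d [:: a1; a2; a3; a4] B) labs) (permutations labs))
  labs) labs) labs) labs) labs by vm_compute.
have /allP/(_ a1 (mem_labs _)) H1 := allP H d (mem_labs _).
have /allP/(_ a3 (mem_labs _)) H2 := allP H1 a2 (mem_labs _).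
have := allP H2 a4 (mem_labs _); rewrite searchE => /hasP[B _].
rewrite searchE => /hasP[d' _ E].
by exists B, d'.
Qed.

(* The label [d = 0] has to be excluded: the edges inside the new path join distinct labels, so at most one new edge can be labelled 0. *)
Lemma extends_path d a :
  d != (false, false) ->
  exists x y z w d', d' != (false, false) /\ extends d [:: a; x; y; z] [:: x; y; z; w] d'.
Proof.
have H : all (fun d => all (fun a => (d != (false, false)) ==>
  has (fun x => has (fun y => has (fun z => has (fun w => has (fun d' =>
    (d' != (false, false)) && extends d [:: a; x; y; z] [:: x; y; z; w] d')
  labs) labs) labs) labs) labs) labs) labs by vm_compute.
move=> d0; have := allP (allP H d (mem_labs _)) a (mem_labs _); rewrite d0.
case/hasP=> x _ /hasP[y _ /hasP[z _ /hasP[w _ /hasP[d' _ /andP[? ?]]]]].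
by exists x, y, z, w, d'.
Qed.

(* A rooted tree on vertices [0, ..., n] in which the vertex [i + 1] has the parent [nth 0 p i <= i] is coded by the list [p]. *)
Fixpoint parent_codes n : seq (seq nat) :=
  if n is n'.+1 then [seq rcons p j | p <- parent_codes n', j <- iota 0 n] else [:: [::]].

Definition code_edges (L : seq lab) (p : seq nat) :=
  [seq addl ab.1 (nth (false, false) L ab.2) | ab <- zip (behead L) p].

(** The root is never counted, even when it is a leaf, so this is a lower bound for the number of
    leaves. *)
Definition code_leaves (p : seq nat) := count (fun i => i \notin p) (iota 1 (size p)).

(* The counts are tabulated before [d] enters, so that they are computed only once. *)
Definition rare_label k (E : seq lab) :=
  let c := [seq (a, count_mem a E) | a <- labs] in
  fun d => all (fun an => an.2 + (an.1 == d) == k) c.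

Lemma rare_labelP k E d a : rare_label k E d -> count_mem a E + (a == d) = k.
Proof. by rewrite /rare_label all_map => /allP/(_ a (mem_labs a))/eqP. Qed.

(** The conditional keeps the leaf count from being evaluated when the test of [d] fails; its first
    branch is the induction invariant. *)
Definition code_labels k (p : seq nat) L :=
  let rare := rare_label k (code_edges L p) in
  fun d => if rare d then (d != (false, false)) || (4 <= code_leaves p) else false.

Lemma code_labels8 p :
  p \in parent_codes 7 ->
  exists L d, [/\ size L = 8, forall a, count_mem a L = 2 & code_labels 2 p L d].
Proof.
(* Adding a constant to all vertex labels preserves every edge label, so the root may be labelled 0
   and only the other seven labels are permuted. *)
pose Ls := [seq (false, false) :: t | t <- permutations (behead (labs ++ labs))].
have HL : all (fun L => (size L == 8) && all (fun a => count_mem a L == 2) labs) Ls.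
  by vm_compute.
have H : all (fun p => search (fun L => search (code_labels 2 p L) labs) Ls) (parent_codes 7).
  by vm_compute.
move=> pc; move: H => /allP/(_ p pc); rewrite searchE => /hasP[L LL].
rewrite searchE => /hasP[d _ E]; exists L, d.
move: HL => /allP/(_ L LL)/andP[/eqP sL /allP cL].
by split=> // a; apply/eqP/cL/mem_labs.
Qed.

(** * Trees built by attaching vertices, and their leaves *)

Section Graph.

Variables (T : finType) (e : rel T).
Hypotheses (eC : symmetric e) (eirr : irreflexive e).

Implicit Types (S : {set T}) (x y z u v w c : T) (l : T -> lab) (p q r : seq T).

Definition attached x v S :=
  [/\ x \notin S, v \in S & forall y, y \in S -> e x y = (y == v)].

(** This form gives direct inductions; [tree_setT] shows that a nonempty connected acyclic graph
    arises in this way. *)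
Inductive tree : {set T} -> Prop :=
| tree_root x : tree [set x]
| tree_attach S x v of tree S & attached x v S : tree (x |: S).

Definition leaf S x v :=
  [/\ x \in S, v \in S & forall y, y \in S -> e x y = (y == v)].

Lemma leaf_neq S x v : leaf S x v -> x != v.
Proof.
by case=> xS vS H; apply/negP => /eqP xv; have := H v vS; rewrite eqxx -xv eirr.
Qed.

Lemma leaf_attached S x v : leaf S x v -> attached x v (S :\ x).
Proof.
move=> L; have xv := leaf_neq L; case: L => xS vS H.
split; first by rewrite !inE eqxx.
  by rewrite !inE eq_sym xv.
by move=> y /setD1P[_]; exact: H.
Qed.

Lemma attached_leaf S x v : attached x v S -> leaf (x |: S) x v.
Proof.
case=> xS vS H; split; rewrite ?setU11 ?setU1r // => y /setU1P[->|/H //].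
by rewrite eirr; apply/esym/negbTE/negP => /eqP xv; rewrite xv vS in xS.
Qed.

Lemma attached_sub S S' x v :
  attached x v S -> S' \subset S -> v \in S' -> attached x v S'.
Proof.
case=> xS vS H sub vS'; split=> //; first by apply: contra xS; apply: (subsetP sub).
by move=> y /(subsetP sub); apply: H.
Qed.

Lemma leaf_attach S x v z u :
  leaf S x v -> attached z u S -> x != u -> leaf (z |: S) x v.
Proof.
case=> xS vS H [zS uS H'] xu; split; rewrite ?setU1r // => y /setU1P[->|/H //].
rewrite eC H' // (negbTE xu); apply/esym/negbTE/negP=> /eqP zv.
by rewrite zv vS in zS.
Qed.

Lemma tree_card S : tree S -> 0 < #|S|.
Proof. by case=> [x|S' x v _ _]; apply/card_gt0P; exists x; rewrite ?set11 ?setU11. Qed.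

Lemma tree_neighbor S y : tree S -> y \in S -> 1 < #|S| -> exists2 w, w \in S & e y w.
Proof.
case=> [x|S' x v tS' at_x]; first by rewrite cards1.
elim: tS' x v at_x y => [x0|S0 x0 v0 tS0 IH at0] x v at_x y yS _.
  case: at_x => xS; rewrite inE => /eqP-> H; have e0 : e x x0 by rewrite H ?inE.
  move: yS; rewrite !inE => /orP[/eqP->|/eqP->].
    by exists x0; rewrite ?inE ?eqxx ?orbT.
  by exists x; rewrite ?inE ?eqxx // eC.
case: at_x => xS vS H; move: yS => /setU1P[->|yS].
  by exists v; rewrite ?H // setU1r.
have [|w wS eyw] := IH _ _ at0 y yS.
  by case: at0 => x0S _ _; rewrite cardsU1 x0S ltnS; apply: tree_card.
by exists w => //; rewrite setU1r.
Qed.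

(** The removal commutes with the last attachment, unless [x] is the vertex attached last or the one
    that carries it. *)
Lemma tree_remove_leaf S x v : tree S -> leaf S x v -> tree (S :\ x).
Proof.
move=> tS; elim: tS x v => [x0|S0 z u tS0 IH at_z] x v.
  move=> L; have := leaf_neq L; case: L; rewrite !inE => /eqP-> /eqP-> _.
  by rewrite eqxx.
move=> L; have [xz|xz] := eqVneq x z.
  by case: at_z => zS _ _; rewrite xz setU1K.
have [xL vL HL] := L; have xS0 : x \in S0 by move: xL; rewrite !inE (negbTE xz).
have [zS uS Hz] := at_z.
(* If [x] carries [z], then [z] is its only neighbour, so [x] has none in [S0] and [S0] is a single
   vertex. *)
have [xu|xu] := eqVneq x u.
  have vz : v = z.
    by apply/esym/eqP; rewrite -HL ?setU11 // eC Hz // xu eqxx.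
  have : #|S0| <= 1.
    rewrite leqNgt; apply/negP=> /(tree_neighbor tS0 xS0)[w wS].
    by rewrite HL ?setU1r // vz => /eqP wz; rewrite -wz wS in zS.
  rewrite leq_eqVlt ltnNge (tree_card tS0) orbF => /cards1P[s S0s].
  suff -> : (z |: S0) :\ x = [set z] by exact: tree_root.
  move: xS0; rewrite S0s inE => /eqP xs; apply/setP=> y; rewrite !inE -xs.
  by case: (eqVneq y x) => //= [->|]; rewrite ?(negbTE xz) ?orbF.
have vz : v != z.
  by apply: contraNneq xu => vz; rewrite -Hz // eC HL ?setU11 // vz.
have vS0 : v \in S0 by move: vL; rewrite !inE (negbTE vz).
have L0 : leaf S0 x v by split=> // y yS; rewrite HL // setU1r.
have -> : (z |: S0) :\ x = z |: (S0 :\ x).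
  apply/setP=> y; rewrite !inE; case: (eqVneq y x) => //= ->.
  by rewrite (negbTE xz).
apply: (tree_attach (v := u)); first exact: IH L0.
by apply: attached_sub at_z _ _; rewrite ?subD1set // !inE eq_sym xu uS.
Qed.

(** After the removal of [x], the vertex [v] would be isolated in a tree with at least two
    vertices. *)
Lemma leaves_nonadjacent S x v w : tree S -> 2 < #|S| -> leaf S x v -> ~ leaf S v w.
Proof.
move=> tS S3 Lx Lv; have xv := leaf_neq Lx.
have [xS vS Hx] := Lx; have [_ _ Hv] := Lv.
have wx : w = x by apply/esym/eqP; rewrite -Hv // eC Hx.
have [||t] := tree_neighbor (tree_remove_leaf tS Lx) (y := v).
- by rewrite !inE eq_sym xv.
- by move: S3; rewrite (cardsD1 x S) xS.
by case/setD1P=> tx tS0; rewrite Hv // wx (negbTE tx).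
Qed.

Lemma leaf_remove S x v y w :
  tree S -> 2 < #|S| -> leaf S x v -> leaf S y w -> x != y -> leaf (S :\ x) y w.
Proof.
move=> tS S3 Lx Ly xy; have [yS wS Hy] := Ly.
have wx : w != x.
  apply/eqP=> wx; rewrite wx in Ly.
  exact: leaves_nonadjacent tS S3 Ly Lx.
split; rewrite ?inE ?wx ?wS ?yS 1?eq_sym ?xy //.
by move=> t /setD1P[_]; apply: Hy.
Qed.

(** * Four leaves, and spiders with at most three legs *)

Definition four_leaves S :=
  exists s : seq T, [/\ uniq s, size s = 4 & forall x, x \in s -> exists v, leaf S x v].

(** If [z] is hung on one of the four leaves, it takes the place of that leaf. *)
Lemma four_leaves_attach S z u :
  four_leaves S -> attached z u S -> four_leaves (z |: S).
Proof.
move=> [s [us s4 Hs]] at_z; have [zS uS Hz] := at_z.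
have sS x : x \in s -> x \in S by move/Hs => [v []].
exists [seq if x == u then z else x | x <- s]; split; rewrite ?size_map //.
  rewrite map_inj_in_uniq // => x y /sS xS /sS yS.
  have nz t : t \in S -> t != z by move=> tS; apply: contraNneq zS => <-.
  do 2![case: eqVneq => ?] => // E; try congruence.
    by move: (nz _ yS); rewrite E eqxx.
  by move: (nz _ xS); rewrite E eqxx.
move=> _ /mapP[x xs ->]; case: eqVneq => xu; first by exists u; apply: attached_leaf.
by have [v L] := Hs x xs; exists v; apply: leaf_attach L at_z xu.
Qed.

(* [leg S c p]: the list [p] is a chain starting next to [c] and running away from it, whose vertices have no other neighbours in [S]. *)
Fixpoint leg S c p : Prop :=
  if p is x :: p' then
    (forall y, y \in S -> e x y = (y == c) || (ohead p' == Some y)) /\ leg S x p'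
  else True.

(** Legs may be empty, so single vertices and paths count as spiders. *)
Definition spider S c p q r :=
  [/\ uniq (c :: p ++ q ++ r), S =i c :: p ++ q ++ r,
      forall y, y \in S ->
        e c y = [|| ohead p == Some y, ohead q == Some y | ohead r == Some y],
      leg S c p & leg S c q /\ leg S c r].

Lemma spider_rot S c p q r : spider S c p q r -> spider S c q r p.
Proof.
case=> U M C Lp [Lq Lr]; split=> //.
- rewrite -(perm_uniq (s1 := c :: p ++ q ++ r)) //.
  by apply/permP=> t; rewrite /= !count_cat; ring.
- by move=> y; rewrite M !inE !mem_cat; do !case: (y \in _) => //; rewrite ?orbT.
- by move=> y /C ->; rewrite orbC -orbA.
Qed.

Lemma spider_swap S c p q r : spider S c p q r -> spider S c q p r.
Proof.
case=> U M C Lp [Lq Lr]; split=> //.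
- by rewrite -(perm_uniq (s1 := c :: p ++ q ++ r)) // perm_cons perm_catCA.
- by move=> y; rewrite M !inE !mem_cat; do !case: (y \in _) => //; rewrite ?orbT.
- by move=> y /C ->; rewrite orbCA.
Qed.

(** The centre of a path slides one step: the old centre joins the opposite leg. *)
Lemma spider_shift S c x p q : spider S c (x :: p) q [::] -> spider S x p (c :: q) [::].
Proof.
case; rewrite !cats0 => U M C /= [Hx Lp] [Lq _].
have P : perm_eq (x :: p ++ c :: q) (c :: (x :: p) ++ q).
  by apply/permP=> t; rewrite /= !count_cat /=; ring.
split; rewrite ?cats0 //.
- by rewrite (perm_uniq P).
- by move=> y; rewrite (perm_mem P).
- by move=> y /Hx ->; rewrite /= orbF orbC (inj_eq Some_inj) [c == y]eq_sym.
- split=> //=; split=> // y /C; rewrite /= orbF => ->.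
  by rewrite (inj_eq Some_inj) eq_sym.
Qed.

(* A spider with an empty leg is a path. *)
Lemma spider_recenter S c p q v :
  spider S c p q [::] -> v \in c :: p -> exists p' q', spider S v p' q' [::].
Proof.
elim: p c q => [|x p IH] c q sp.
  by rewrite mem_seq1 => /eqP->; exists [::], q.
rewrite inE => /orP[/eqP->|]; first by exists (x :: p), q.
exact: IH (spider_shift sp).
Qed.

Lemma spider_path_end S c p q :
  spider S c p q [::] -> exists c' p', spider S c' p' [::] [::].
Proof.
elim: p c q => [|x p IH] c q sp; last exact: IH (spider_shift sp).
by exists c, q; apply: spider_swap.
Qed.

Lemma leg_attach S c p z v :
  leg S c p -> attached z v S -> c \in S -> {subset p <= S} -> v \notin p ->
  leg (z |: S) c p.
Proof.
move=> L [zS vS Hz]; elim: p c L => //= x p IH c [Hx L] cS pS.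
rewrite inE negb_or => /andP[vx vp]; have xS : x \in S by apply: pS; rewrite mem_head.
split; last by apply: IH => // y yp; apply: pS; rewrite inE yp orbT.
move=> y /setU1P[->|/Hx //]; rewrite eC Hz // eq_sym (negbTE vx).
have nz t : t \in S -> t != z by move=> tS; apply: contraNneq zS => <-.
rewrite [z == c]eq_sym (negbTE (nz c cS)) /=; case: p pS {IH L Hx vp} => //= w p pS.
by rewrite (inj_eq Some_inj) (negbTE (nz w _)) // pS // !inE eqxx orbT.
Qed.

Lemma leg_extend S c p z :
  leg S c p -> attached z (last c p) S -> uniq (c :: p) -> c \in S ->
  {subset p <= S} -> leg (z |: S) c (rcons p z).
Proof.
move=> L at_z; elim: p c L at_z => /= [|x p IH] c.
  move=> _ at_z _ _ _; have [_ _ H] := attached_leaf at_z.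
  by split=> // y yS; rewrite H // orbF.
move=> [Hx L] at_z /andP[cp U] cS pS; have xS : x \in S by apply: pS; rewrite mem_head.
have [zS _ Hz] := at_z.
have nz t : t \in S -> t != z by move=> tS; apply: contraNneq zS => <-.
split; last first.
  by apply: IH => // y yp; apply: pS; rewrite inE yp orbT.
case: p at_z U pS Hx Hz {IH L cp} => /= [|w p] at_z U pS Hx Hz y /setU1P[->|yS].
- by rewrite eC Hz // !eqxx orbT.
- by rewrite Hx // (inj_eq Some_inj) [z == y]eq_sym (negbTE (nz y yS)).
- rewrite eC Hz // [z == c]eq_sym (negbTE (nz c cS)) /=.
  rewrite (inj_eq Some_inj) (negbTE (nz w _)); last by rewrite pS // !inE eqxx orbT.
  by apply/negbTE/negP => /eqP xl; move/andP: U; rewrite xl (mem_last w p) => -[].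
- by rewrite Hx.
Qed.

Lemma leg_last S c p x :
  leg S c (rcons p x) -> c \in S -> {subset rcons p x <= S} -> leaf S x (last c p).
Proof.
elim: p c => [|w p IH] c /=.
  move=> [Hx _] cS pS; split=> //; first by rewrite pS ?mem_head.
  by move=> y /Hx ->; rewrite orbF.
move=> [_ L] _ pS; apply: IH => //; first by apply: pS; rewrite mem_head.
by move=> y yp; apply: pS; rewrite inE yp orbT.
Qed.

Lemma leg_sub S S' c p : S' \subset S -> leg S c p -> leg S' c p.
Proof.
move=> /subsetP sub; elim: p c => //= x p IH c [Hx L].
by split; [move=> y /sub /Hx | apply: IH].
Qed.

Lemma leg_shrink S c p x : leg S c (rcons p x) -> leg (S :\ x) c p.
Proof.
elim: p c => //= w p IH c [Hw L]; split; last exact: IH.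
move=> y /setD1P[yx yS]; rewrite Hw //; case: p {IH L Hw} => //=.
by rewrite (inj_eq Some_inj) [x == y]eq_sym (negbTE yx).
Qed.

(** An empty [p] is set apart: the spider is then a path, which [spider_attach_path] covers. *)
Lemma spider_attach_tip S c p q r z :
  spider S c p q r -> attached z (last c p) S ->
  spider (z |: S) c (rcons p z) q r \/ p = [::].
Proof.
case: p => [|x p]; first by right.
case=> U M C Lp [Lq Lr] at_z; left; have [zS lS Hz] := at_z.
have cS : c \in S by rewrite M mem_head.
have sub s : {subset s <= (x :: p) ++ q ++ r} -> {subset s <= S}.
  by move=> ss y /ss ys; rewrite M inE ys orbT.
have subp : {subset x :: p <= S} by apply: sub => y yp; rewrite mem_cat yp.
have subq : {subset q <= S} by apply: sub => y yp; rewrite !mem_cat yp orbT.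
have subr : {subset r <= S} by apply: sub => y yp; rewrite !mem_cat yp !orbT.
have Up : uniq (c :: x :: p).
  by move: U; rewrite -cat_cons cat_uniq => /andP[].
have lp : last x p \in x :: p by exact: mem_last.
have lqr : last x p \notin q ++ r.
  by move: U; rewrite -cat_cons cat_uniq => /and3P[_ /hasPn H _]; apply/negP=> /H; rewrite inE lp orbT.
have lc : last x p != c.
  by move: Up => /andP[cp _]; apply: contraNneq cp => <-.
have P : perm_eq (c :: rcons (x :: p) z ++ q ++ r) (z :: c :: (x :: p) ++ q ++ r).
  by apply/permP=> t; rewrite -cats1 /= !count_cat /=; set a := nat_of_bool _; ring.
split.
- by rewrite (perm_uniq P) cons_uniq -M zS.
- by move=> y; rewrite (perm_mem P) in_cons in_setU1 M.
- move=> y /setU1P[->|/C //]; rewrite eC Hz // eq_sym (negbTE lc) /=.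
  have hz s : {subset s <= S} -> (ohead s == Some z) = false.
    case: s => //= w s sS; rewrite (inj_eq Some_inj); apply/negbTE/negP => /eqP wz.
    by rewrite -wz sS // mem_head in zS.
  rewrite !hz // (inj_eq Some_inj) !orbF; apply/esym/negbTE/negP => /eqP xz.
  by rewrite -xz subp // mem_head in zS.
- exact: leg_extend.
- by move: lqr; rewrite mem_cat negb_or => /andP[lq lr]; split; apply: leg_attach; eauto.
Qed.


(** Once the path is recentred at [v], the new vertex is a third leg of length one. *)
Lemma spider_attach_path S c p q z v :
  spider S c p q [::] -> attached z v S -> exists p' q', spider (z |: S) v p' q' [:: z].
Proof.
move=> sp at_z; have [zS vS Hz] := at_z.
have [p' [q']] : exists p' q', spider S v p' q' [::].
  have [vp|vp] := boolP (v \in c :: p); first exact: spider_recenter sp vp.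
  apply: spider_recenter (spider_swap sp) _; case: sp => _ M _ _ _.
  by move: vS; rewrite M cats0 -cat_cons mem_cat (negbTE vp) in_cons /= => ->; rewrite orbT.
case; rewrite cats0 => U M C Lp [Lq _]; exists p', q'.
have P : perm_eq (v :: p' ++ q' ++ [:: z]) (z :: v :: p' ++ q').
  by apply/permP=> t; rewrite /= !count_cat /=; ring.
have /and3P[vpq Upq _] : [&& v \notin p' ++ q', uniq (p' ++ q') & true] by rewrite andbT.
move: vpq; rewrite mem_cat negb_or => /andP[vp vq].
split.
- by rewrite (perm_uniq P) cons_uniq -M zS.
- by move=> y; rewrite (perm_mem P) in_cons in_setU1 M.
- move=> y /setU1P[->|yS]; rewrite /= (inj_eq Some_inj).
    by rewrite eC Hz // !eqxx !orbT.
  rewrite C //= orbF; case: (eqVneq z y) => [zy|]; last by rewrite orbF.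
  by rewrite zy yS in zS.
- by apply: leg_attach at_z _ _ vp => // y yp; rewrite M inE mem_cat yp orbT.
- split; first by apply: leg_attach at_z _ _ vq => // y yp; rewrite M inE mem_cat yp !orbT.
  by split=> // y yS; rewrite orbF; have [_ _ ->] := attached_leaf at_z.
Qed.

Lemma spider_leaf S c p q r x :
  spider S c (rcons p x) q r -> leaf S x (last c p) /\ spider (S :\ x) c p q r.
Proof.
case=> U M C Lp [Lq Lr].
have P : perm_eq (c :: rcons p x ++ q ++ r) (x :: c :: p ++ q ++ r).
  by apply/permP=> t; rewrite -cats1 /= !count_cat /=; set a := nat_of_bool _; ring.
split; first apply: leg_last Lp _ _; first by rewrite M mem_head.
  by move=> y yp; rewrite M inE mem_cat yp orbT.
move: U; rewrite (perm_uniq P) cons_uniq => /andP[xn U].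
have sub : S :\ x \subset S by exact: subD1set.
split=> //.
- move=> y; rewrite in_setD1 M (perm_mem P) in_cons.
  by case: eqVneq => //= ->; apply/esym/negbTE.
- move=> y /setD1P[yx yS]; rewrite C //; case: p {Lp xn U P M C} => //=.
  by rewrite (inj_eq Some_inj) [x == y]eq_sym (negbTE yx).
- exact: leg_shrink Lp.
- by split; apply: leg_sub sub _.
Qed.

(** Attaching a vertex to a path gives a spider. With three nonempty legs, the new vertex either
    prolongs a leg at its tip or forms four leaves together with the three tips. *)
Lemma spider_or_four_leaves S :
  tree S -> (exists c p q r, spider S c p q r) \/ four_leaves S.
Proof.
elim=> [x|S0 z v tS0 [[c [p [q [r sp]]]]|F] at_z].
- left; exists x, [::], [::], [::]; split=> // [y|y]; first by rewrite !inE.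
  by rewrite inE => /eqP->; rewrite eirr.
- have path_case p' q' : spider S0 c p' q' [::] ->
    (exists c p q r, spider (z |: S0) c p q r) \/ four_leaves (z |: S0).
    move=> sp'; left; have [p1 [q1 H]] := spider_attach_path sp' at_z.
    by exists v, p1, q1, [:: z].
  have sp1 := spider_rot sp; have sp2 := spider_rot sp1.
  have [r0|rN] := eqVneq r [::]; first by apply: (path_case p q); rewrite -r0.
  have [p0|pN] := eqVneq p [::]; first by apply: (path_case q r); rewrite -p0.
  have [q0|qN] := eqVneq q [::]; first by apply: (path_case r p); rewrite -q0.
  have tip p' q' r' : spider S0 c p' q' r' -> p' != [::] -> v = last c p' ->
    (exists c p q r, spider (z |: S0) c p q r) \/ four_leaves (z |: S0).
    move=> sp' p'N vl; rewrite vl in at_z.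
    have [H|H] := spider_attach_tip sp' at_z; last by rewrite H in p'N.
    by left; exists c, (rcons p' z), q', r'.
  have [vp|vp] := eqVneq v (last c p); first exact: tip sp pN vp.
  have [vq|vq] := eqVneq v (last c q); first exact: tip sp1 qN vq.
  have [vr|vr] := eqVneq v (last c r); first exact: tip sp2 rN vr.
  right; have [zS _ _] := at_z.
  case/lastP: p pN vp sp {sp1 sp2 tip path_case} => // p x _; rewrite last_rcons => vx sp.
  case/lastP: q qN vq sp => // q y _; rewrite last_rcons => vy sp.
  case/lastP: r rN vr sp => // r w _; rewrite last_rcons => vw sp.
  have [Lx _] := spider_leaf sp; have [Ly _] := spider_leaf (spider_rot sp).
  have [Lw _] := spider_leaf (spider_rot (spider_rot sp)).
  have [xS _ _] := Lx; have [yS _ _] := Ly; have [wS _ _] := Lw.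
  have nz t : t \in S0 -> t != z by move=> tS; apply: contraNneq zS => <-.
  (* The tips form a subsequence of the duplicate-free listing of the spider. *)
  have U : uniq [:: x; y; w].
    case: sp => U _ _ _ _; apply: subseq_uniq U.
    apply: subseq_trans (subseq_cons _ c).
    rewrite -[_ :: _]/([:: x] ++ [:: y] ++ [:: w]).
    by do !apply: cat_subseq; rewrite -cats1 suffix_subseq.
  exists [:: z; x; y; w]; split=> //.
    rewrite cons_uniq U andbT !inE !negb_or ![z == _]eq_sym.
    by rewrite !nz.
  move=> t; rewrite !inE => /or4P[] /eqP->.
  + by exists v; apply: attached_leaf.
  + by eexists; apply: leaf_attach Lx at_z _; rewrite eq_sym.
  + by eexists; apply: leaf_attach Ly at_z _; rewrite eq_sym.
  + by eexists; apply: leaf_attach Lw at_z _; rewrite eq_sym.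
- by right; apply: four_leaves_attach F at_z.
Qed.

(** * Sequences of attachments, and the removal of leaves or of a pendant path *)

(** A pair [(x, v)] hangs the new vertex [x] on [v], so [unzip1] lists the new vertices and [unzip2]
    the vertices that carry them. *)
Fixpoint grow S (s : seq (T * T)) : {set T} :=
  if s is (x, _) :: s' then grow (x |: S) s' else S.

Fixpoint grows S (s : seq (T * T)) : Prop :=
  if s is (x, v) :: s' then attached x v S /\ grows (x |: S) s' else True.

Lemma grow_cat S s t : grow S (s ++ t) = grow (grow S s) t.
Proof. by elim: s S => //= -[x v] s IH S. Qed.

Lemma grows_cat S s t : grows S s -> grows (grow S s) t -> grows S (s ++ t).
Proof. by elim: s S => //= -[x v] s IH S [at_x gs] gt; split; last exact: IH. Qed.

Lemma mem_grow S s x : (x \in grow S s) = (x \in unzip1 s) || (x \in S).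
Proof.
elim: s S => //= -[y v] s IH S; rewrite IH in_cons in_setU1 /=.
by rewrite orbCA orbA.
Qed.

Lemma grows_notin S s x : grows S s -> x \in unzip1 s -> x \notin S.
Proof.
elim: s S => //= -[y v] s IH S [[yS _ _] gs]; rewrite in_cons => /orP[/eqP-> //|xs].
by apply: contra (IH _ gs xs) => xS; rewrite setU1r.
Qed.

Lemma grows_uniq S s : grows S s -> uniq (unzip1 s).
Proof.
elim: s S => //= -[y v] s IH S [_ gs]; rewrite (IH _ gs) andbT.
by apply/negP => /(grows_notin gs); rewrite setU11.
Qed.

Lemma card_grow S s : grows S s -> #|grow S s| = #|S| + size s.
Proof.
elim: s S => [|[y v] s IH] S /=; first by rewrite addn0.
by move=> [[yS _ _] gs]; rewrite IH // cardsU1 yS addnS.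
Qed.

Lemma four_leaves_grow S s : four_leaves S -> grows S s -> four_leaves (grow S s).
Proof.
elim: s S => //= -[y v] s IH S F [at_y gs].
by apply: IH => //; apply: four_leaves_attach at_y.
Qed.

Lemma leaf_grow S s x v :
  leaf S x v -> grows S s -> x \notin unzip2 s -> leaf (grow S s) x v.
Proof.
elim: s S => //= -[y u] s IH S L [at_y gs]; rewrite in_cons negb_or => /andP[xu xs].
by apply: IH => //; apply: leaf_attach at_y _.
Qed.

Lemma grows_leaf S s x v :
  grows S s -> (x, v) \in s -> x \notin unzip2 s -> leaf (grow S s) x v.
Proof.
elim: s S => //= -[y u] s IH S [at_y gs]; rewrite !in_cons negb_or => H /andP[xu xs].
case/orP: H => [/eqP[xy vu]|xvs]; last exact: IH.
by apply: leaf_grow => //; rewrite xy vu; apply: attached_leaf.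
Qed.

(** Leaves are pairwise nonadjacent, so each removed leaf hangs on a surviving vertex, whose label
    is unaffected when the leaves are relabelled. The size bound keeps more than two vertices
    throughout. *)
Lemma remove_leaves S (s : seq T) :
  tree S -> uniq s -> (forall x, x \in s -> exists v, leaf S x v) ->
  size s + 2 < #|S| ->
  exists S' t, [/\ tree S', grows S' t, grow S' t = S,
    unzip1 t = rev s & {subset unzip2 t <= S'}].
Proof.
elim: s S => [|x s IH] S tS /=; first by exists S, [::].
case/andP=> xs us Ls cS; have [v Lx] := Ls x (mem_head x s).
have [xS vS _] := Lx; have S3 : 2 < #|S| by lia.
have Ls' y : y \in s -> exists w, leaf (S :\ x) y w.
  move=> ys; have [|w Ly] := Ls y; first by rewrite in_cons ys orbT.
  exists w; apply: leaf_remove tS S3 Lx Ly _.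
  by apply: contraNneq xs => ->.
have [|S' [t [tS' gt Et ut vt]]] := IH _ (tree_remove_leaf tS Lx) us Ls'.
  by move: cS; rewrite (cardsD1 x S) xS; lia.
have at_x : attached x v (grow S' t) by rewrite Et; apply: leaf_attached.
exists S', (rcons t (x, v)); rewrite -cats1; split=> //.
- by apply: grows_cat.
- by rewrite grow_cat Et /= setD1K.
- by rewrite /unzip1 map_cat -/(unzip1 t) ut rev_cons -cats1.
move=> y; rewrite /unzip2 map_cat mem_cat mem_seq1 => /orP[/vt //|/eqP-> /=].
(* Either [v] lies in [S'], or it is one of the other removed leaves, which contradicts
   nonadjacency. *)
have [_ vt' _] := at_x; move: vt'; rewrite mem_grow ut mem_rev => /orP[vs|//].
have [|w Lv] := Ls v; first by rewrite in_cons vs orbT.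
by case: (leaves_nonadjacent tS S3 Lx Lv).
Qed.

(** The four outermost vertices of the leg are stripped; [a] is the vertex before them, which is the
    centre when the leg has exactly four. *)
Lemma spider_pendant_path S c p q r :
  tree S -> spider S c p q r -> 4 <= size p ->
  exists S' a x y z w, let t := [:: (x, a); (y, x); (z, y); (w, z)] in
    [/\ tree S', a \in S', grows S' t & grow S' t = S].
Proof.
move=> tS sp.
case/lastP: p sp => // p w sp; case/lastP: p sp => // p z sp.
case/lastP: p sp => // p y sp; case/lastP: p sp => // p x sp _.
have [Lw sp1] := spider_leaf sp; have [Lz sp2] := spider_leaf sp1.
have [Ly sp3] := spider_leaf sp2; have [Lx _] := spider_leaf sp3.
rewrite !last_rcons in Lw Lz Ly; have at_x := leaf_attached Lx.
have mem T0 u v : leaf T0 u v -> u \in T0 by case.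
exists (S :\ w :\ z :\ y :\ x), (last c p), x, y, z, w; split.
- apply: tree_remove_leaf Lx; apply: tree_remove_leaf Ly.
  by apply: tree_remove_leaf Lz; apply: tree_remove_leaf Lw.
- by case: at_x.
- rewrite /= setD1K ?(mem _ _ _ Lx) // setD1K ?(mem _ _ _ Ly) //.
  rewrite setD1K ?(mem _ _ _ Lz) //.
  by split; [|split; [|split; [|split]]]; rewrite //; apply: leaf_attached.
- rewrite /= setD1K ?(mem _ _ _ Lx) // setD1K ?(mem _ _ _ Ly) //.
  by rewrite setD1K ?(mem _ _ _ Lz) // setD1K ?(mem _ _ _ Lw).
Qed.

(** * Label counts along a growing tree *)

Definition cV S l (a : lab) := #|[set v in S | l v == a]|.

Definition cE S l (a : lab) :=
  #|[set [set x; y] | x in S, y in S & e x y && (addl (l x) (l y) == a)]|.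

Lemma cV_attach S x v l a : attached x v S -> cV (x |: S) l a = (l x == a) + cV S l a.
Proof.
case=> xS _ _; rewrite /cV.
have -> : [set w in x |: S | l w == a] =
  (if l x == a then [set x] else set0) :|: [set w in S | l w == a].
  apply/setP=> w; case: ifP => la; rewrite !inE; case: (eqVneq w x) => [->|wx] //=.
  by rewrite la (negbTE xS).
by case: eqP => _; rewrite ?set0U // cardsU1 !inE (negbTE xS).
Qed.

(** The edge from [x] to [v] is the only one added, and it was not counted before because [x] is
    outside [S]. *)
Lemma cE_attach S x v l a :
  attached x v S -> cE (x |: S) l a = (addl (l x) (l v) == a) + cE S l a.
Proof.
case=> xS vS Hx; rewrite /cE; set E := [set _ | y in S, z in S & _].
have En : [set x; v] \notin E.
  apply: contra xS => /imset2P[y z yS]; rewrite inE => /andP[zS _] xyz.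
  by have := set21 x v; rewrite xyz !inE => /orP[/eqP->|/eqP->].
set E' := imset2 _ _ _.
have -> : E' = (if addl (l x) (l v) == a then [set [set x; v]] else set0) :|: E.
  apply/setP=> A; apply/imset2P/setUP.
    case=> y z; rewrite !inE => /orP[/eqP->|yS] /and3P[/orP[/eqP->|zS]].
    - by rewrite eirr.
    - by rewrite Hx // => /eqP-> -> ->; left; rewrite set11.
    - by rewrite eC Hx // => /eqP->; rewrite addlC => -> ->; left; rewrite setUC set11.
    - move=> eyz la ->; right; apply/imset2P; exists y z => //.
      by rewrite inE zS eyz.
  case=> [|/imset2P[y z yS]].
    case: ifP => [la|]; rewrite inE // => /eqP->.
    by exists x v; rewrite ?inE ?eqxx // vS orbT la Hx // eqxx.
  rewrite inE => /and3P[zS eyz la] ->.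
  by exists y z; rewrite ?inE ?yS ?zS ?orbT ?eyz.
by case: eqP => _; rewrite ?set0U // cardsU1 En.
Qed.

Lemma cV_grow S s l a :
  grows S s -> cV (grow S s) l a = cV S l a + count_mem a [seq l x | x <- unzip1 s].
Proof.
elim: s S => [|[x v] s IH] S /=; first by rewrite addn0.
by move=> [at_x gs]; rewrite IH // (cV_attach _ _ at_x) addnCA addnA.
Qed.

Lemma cE_grow S s l a :
  grows S s ->
  cE (grow S s) l a = cE S l a + count_mem a [seq addl (l xv.1) (l xv.2) | xv <- s].
Proof.
elim: s S => [|[x v] s IH] S /=; first by rewrite addn0.
by move=> [at_x gs]; rewrite IH // (cE_attach _ _ at_x) addnCA addnA.
Qed.

Lemma eq_cV S l l' a : {in S, l =1 l'} -> cV S l a = cV S l' a.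
Proof.
by move=> ll'; apply: eq_card => x; rewrite !inE; case: (boolP (x \in S)) => //= /ll' ->.
Qed.

Lemma eq_cE S l l' a : {in S, l =1 l'} -> cE S l a = cE S l' a.
Proof.
move=> ll'; congr #|pred_of_set _|; apply/setP=> A.
by apply/imset2P/imset2P=> -[x y xS]; rewrite inE => /andP[yS H] ->;
  exists x y; rewrite // inE yS; move: H; rewrite !ll'.
Qed.

(* The number of edges is [4 k - 1], so exactly one edge label, [d], is used only [k - 1] times. *)
Definition balanced S k d l :=
  forall a, cV S l a = k /\ cE S l a + (a == d) = k.

Definition relabel l (xs : seq T) (B : seq lab) x :=
  if x \in xs then nth (l x) B (index x xs) else l x.

Lemma map_relabel l xs B :
  uniq xs -> size B = size xs -> [seq relabel l xs B x | x <- xs] = B.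
Proof.
move=> U sB; apply: (@eq_from_nth _ (false, false)); rewrite size_map //.
move=> i ix; have x0 : T by case: xs ix {U sB}.
rewrite (nth_map x0) // /relabel mem_nth // index_uniq //.
(* The default value in [relabel] varies with the vertex, but no index falls outside [B]. *)
by apply: set_nth_default; rewrite sB.
Qed.

Lemma relabel_notin l xs B x : x \notin xs -> relabel l xs B x = l x.
Proof. by rewrite /relabel => /negbTE->. Qed.

Lemma edge_labels l (s : seq (T * T)) :
  [seq addl (l xv.1) (l xv.2) | xv <- s] =
  [seq addl ab.1 ab.2 | ab <- zip (map l (unzip1 s)) (map l (unzip2 s))].
Proof. by elim: s => //= xv s ->. Qed.

(** The new edge labels move the shortage from [d] to [d']. *)
Lemma balanced_extend S k d l s B d' :
  balanced S k d l -> grows S s -> size s = 4 ->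
  extends d [seq relabel l (unzip1 s) B v | v <- unzip2 s] B d' ->
  balanced (grow S s) k.+1 d' (relabel l (unzip1 s) B).
Proof.
move=> bal gs s4 /andP[/eqP B4 /allP ext] a; have [bV bE] := bal a.
have /andP[/eqP eV /eqP eE] := ext a (mem_labs a).
have U := grows_uniq gs; have sB : size B = size (unzip1 s) by rewrite size_map s4.
have ll' : {in S, relabel l (unzip1 s) B =1 l}.
  by move=> x xS; apply: relabel_notin; apply/negP=> /(grows_notin gs); rewrite xS.
rewrite cV_grow // cE_grow // (eq_cV _ ll') (eq_cE _ ll') bV edge_labels.
by rewrite map_relabel // eV addn1; split=> //; rewrite -addnA eE addnCA bE.
Qed.

(** * From parent lists back to trees *)

Definition code (r : T) (s : seq (T * T)) := [seq index v (r :: unzip1 s) | v <- unzip2 s].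

Lemma tree_code S :
  tree S -> exists (r : T) s,
    [/\ grows [set r] s, grow [set r] s = S & code r s \in parent_codes (size s)].
Proof.
(* The strengthened claim says that every carrying vertex is listed, so its index is unchanged when
   a vertex is appended. *)
move=> tS; suff [r [s [gs Es sub cs]]] : exists (r : T) s,
    [/\ grows [set r] s, grow [set r] s = S,
        {subset unzip2 s <= r :: unzip1 s} & code r s \in parent_codes (size s)].
  by exists r, s.
elim: tS => [r|S0 x v tS0 [r [s [gs Es sub cs]]] at_x]; first by exists r, [::].
have vs : v \in r :: unzip1 s.
  have [_ + _] := at_x; rewrite -Es mem_grow !inE orbC.
  by case/orP=> [->|->]; rewrite ?orbT.
have idx y : y \in r :: unzip1 s ->
    index y (r :: unzip1 (rcons s (x, v))) = index y (r :: unzip1 s).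
  by move=> ys; rewrite /unzip1 map_rcons -rcons_cons -cats1 index_cat ys.
exists r, (rcons s (x, v)); split.
- by rewrite -cats1; apply: grows_cat; rewrite ?Es.
- by rewrite -cats1 grow_cat Es.
- move=> y; rewrite /unzip1 /unzip2 !map_rcons -rcons_cons !mem_rcons !in_cons => H.
  apply/orP; right; case/orP: H => [/eqP->|/sub]; first by rewrite -in_cons.
  by rewrite -in_cons.
have -> : code r (rcons s (x, v)) = rcons (code r s) (index v (r :: unzip1 s)).
  rewrite /code /unzip2 !map_rcons idx //; congr rcons.
  by apply/eq_in_map=> y /sub; apply: idx.
rewrite size_rcons.
apply/allpairsP; exists (code r s, index v (r :: unzip1 s)); split=> //.
change (index v (r :: unzip1 s) \in iota 0 (size s).+1); rewrite mem_iota add0n.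
by rewrite -(size_map fst s) -[(size _).+1]/(size (r :: unzip1 s)) index_mem.
Qed.

Lemma balanced_code (r : T) s k L d :
  grows [set r] s -> size L = (size s).+1 -> (forall a : lab, count_mem a L = k) ->
  rare_label k (code_edges L (code r s)) d ->
  exists l, balanced (grow [set r] s) k d l.
Proof.
move=> gs sL hV H; set us := r :: unzip1 s.
have rs : r \notin unzip1 s by apply/negP=> /(grows_notin gs); rewrite set11.
have uus : uniq us by rewrite /= rs (grows_uniq gs).
have sus : size us = (size s).+1 by rewrite /= size_map.
(* Each vertex takes the label at its position in the order of construction. *)
pose l x := nth (false, false) L (index x us).
have mapl : [seq l x | x <- us] = L.
  apply: (@eq_from_nth _ (false, false)); rewrite size_map sus ?sL // => i ix.
  by rewrite (nth_map r) ?sus // /l index_uniq ?sus.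
exists l => a; have hE := rare_labelP a H.
  rewrite cV_grow // cE_grow // edge_labels; split.
    rewrite -(hV a) -mapl /=; congr (_ + _); rewrite /cV.
    case: (boolP (l r == a)) => lr /=.
      by apply/eqP/cards1P; exists r; apply/setP=> y; rewrite !inE; case: eqP => // ->.
    by apply/eqP; rewrite cards_eq0; apply/eqP/setP=> y; rewrite !inE; case: eqP => // ->; apply/negbTE.
  rewrite -hE; congr (_ + _).
  have -> : cE [set r] l a = 0.
    apply/eqP; rewrite cards_eq0; apply/eqP/setP=> A; rewrite inE.
    apply/negbTE/imset2P=> -[y z]; rewrite !inE => /eqP-> /and3P[/eqP->].
    by rewrite eirr.
  have bL : behead L = [seq l x | x <- unzip1 s] by rewrite -mapl.
  rewrite add0n /code_edges bL /code -/us; congr (count_mem a _).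
  suff E (p q : seq T) : [seq addl ab.1 ab.2 | ab <- zip (map l p) (map l q)] =
    [seq addl ab.1 (nth (false, false) L ab.2)
       | ab <- zip (map l p) [seq index v us | v <- q]] by [].
  by elim: p q => [|x p IH] [|v q] //; rewrite [LHS]/= IH.
Qed.

Lemma code_four_leaves (r : T) s :
  grows [set r] s -> 4 <= code_leaves (code r s) -> four_leaves (grow [set r] s).
Proof.
move=> gs c4; set us := r :: unzip1 s.
have rs : r \notin unzip1 s by apply/negP=> /(grows_notin gs); rewrite set11.
have uus : uniq us by rewrite /= rs (grows_uniq gs).
have sus : size us = (size s).+1 by rewrite /= size_map.
(* Nothing is hung on the vertices of [F], so they are leaves; the positions absent from the code
   inject into the positions of [F]. *)
pose F := [seq x <- unzip1 s | x \notin unzip2 s].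
have sF : 4 <= size F.
  apply: leq_trans c4 _; rewrite size_filter /code_leaves.
  have -> : unzip1 s = [seq nth r us i | i <- iota 1 (size (code r s))].
    apply: (@eq_from_nth _ r); rewrite !size_map ?size_iota ?size_map // => i ix.
    by rewrite [RHS](nth_map 0) ?size_iota ?size_map // nth_iota ?size_map.
  rewrite count_map -!size_filter; apply: uniq_leq_size => [|i].
    by rewrite filter_uniq // iota_uniq.
  rewrite !mem_filter mem_iota size_map => /andP[ip /andP[i1 i2]].
  rewrite i1 i2 !andbT /=.
  apply: contra ip => iv; have <- : index (nth r us i) us = i.
    by rewrite index_uniq // sus; move: i2; rewrite add1n size_map.
  exact: (map_f (index^~ us)).
exists (take 4 F); split.
- by rewrite take_uniq // filter_uniq // (grows_uniq gs).
- by rewrite size_takel.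
move=> x /mem_take; rewrite mem_filter => /andP[x2 /mapP[[y v] xs /= xy]].
by exists v; apply: grows_leaf gs _ x2; rewrite xy.
Qed.

(** * The induction from eight vertices on *)

Lemma grow_leaves S :
  tree S -> 6 < #|S| -> four_leaves S ->
  exists2 S', tree S' /\ #|S'| + 4 = #|S| &
    forall k d l, balanced S' k d l -> exists l' d', balanced S k.+1 d' l'.
Proof.
move=> tS S6 [s [us s4 Ls]].
have [|S' [t [tS' gt Et ut vt]]] := remove_leaves tS us Ls; first by rewrite s4.
have t4 : size t = 4 by rewrite -(size_map fst) -/(unzip1 t) ut size_rev.
exists S'; first by rewrite -Et card_grow // t4.
move=> k d l bal; rewrite -Et.
have [B [d' ext]] : exists B d', extends d [seq l v | v <- unzip2 t] B d'.
  by case: t t4 {gt Et ut vt} => [|? [|? [|? [|? []]]]] // _; apply: extends_leaves.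
exists (relabel l (unzip1 t) B), d'; apply: (balanced_extend bal gt t4).
congr extends: ext; apply/eq_in_map=> v /vt vS; rewrite relabel_notin //.
by apply/negP=> /(grows_notin gt); rewrite vS.
Qed.

Lemma tree_balanced k S :
  tree S -> #|S| = 4 * k.+2 ->
  exists l d, balanced S k.+2 d l /\ (d != (false, false) \/ four_leaves S).
Proof.
elim: k S => [|k IH] S tS cS.
  have [r [s [gs Es cs]]] := tree_code tS.
  have s7 : size s = 7 by move: cS; rewrite -Es card_grow // cards1; lia.
  rewrite s7 in cs; have [L [d [sL cL code_ok]]] := code_labels8 cs.
  move: code_ok; rewrite /code_labels; case: ifP => // rare dH.
  have [|l bal] := balanced_code gs _ cL rare; first by rewrite s7.
  exists l, d; rewrite -Es; split=> //.
  by case/orP: dH => [|c4]; [left | right; apply: code_four_leaves].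
(* Four leaves in [S] already give the invariant, so the new rare label may be anything. *)
have leaves_case : four_leaves S ->
    exists l d, balanced S k.+3 d l /\ (d != (false, false) \/ four_leaves S).
  move=> F; have [|S' [tS' cS'] ext] := grow_leaves tS _ F; first by lia.
  have [|l [d [bal _]]] := IH S' tS'; first by lia.
  by have [l' [d' bal']] := ext _ _ _ bal; exists l', d'; split; [|right].
have [[c [p [q [r sp]]]]|] := spider_or_four_leaves tS; last exact: leaves_case.
(* The legs have at least 11 vertices in all, so one of them has at least four. *)
have [c' [p' [q' [r' [sp' p4]]]]] : exists c p q r, spider S c p q r /\ 4 <= size p.
  have size_pqr : size p + (size q + size r) = 4 * k.+3 - 1.
    case: sp => U M _ _ _; have := card_uniqP U; rewrite -(eq_card M) cS /= !size_cat.
    by lia.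
  have [p4|p4] := leqP 4 (size p); first by exists c, p, q, r.
  have [q4|q4] := leqP 4 (size q); first by exists c, q, r, p; split; [apply: spider_rot|].
  exists c, r, p, q; split; first by do 2!apply: spider_rot.
  by lia.
have [S' [a [x [y [z [w]]]]]] := spider_pendant_path tS sp' p4.
move=> -[tS' aS' gt Et]; pose t := [:: (x, a); (y, x); (z, y); (w, z)].
rewrite -/t in gt Et.
have cS' : #|S'| = 4 * k.+2.
  by have := card_grow gt; rewrite Et cS /=; lia.
have [l [d [bal [d0|F]]]] := IH S' tS' cS'; last first.
  by apply: leaves_case; rewrite -Et; apply: four_leaves_grow.
have [b1 [b2 [b3 [b4 [d' [d0' ext]]]]]] := extends_path (l a) d0.
exists (relabel l (unzip1 t) [:: b1; b2; b3; b4]), d'; split; last by left.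
rewrite -Et; apply: (balanced_extend bal gt) => //.
(* Of the vertices that carry new ones, [x], [y], [z] are relabelled themselves, while [a] keeps its
   label. *)
have := map_relabel l (grows_uniq gt) (B := [:: b1; b2; b3; b4]) erefl.
rewrite /t /= => -[-> -> -> _]; rewrite relabel_notin //.
by apply/negP=> /(grows_notin gt); rewrite aS'.
Qed.

(** * From connected acyclic graphs to successive attachments *)

Lemma tree_path S x y :
  tree S -> x \in S -> y \in S ->
  exists s, [/\ path e x s, last x s = y, uniq (x :: s) & {subset s <= S}].
Proof.
move=> tS; elim: tS x y => [r|S0 z v tS0 IH [zS vS Hz]] x y.
  by rewrite !inE => /eqP-> /eqP->; exists [::].
have zv : e z v by rewrite Hz.
rewrite !in_setU1 => /orP[/eqP->|xS] /orP[/eqP->|yS].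
- by exists [::].
- have [s [ps ls us ss]] := IH v y vS yS; exists (v :: s); split=> //.
  + by rewrite /= zv.
  + rewrite cons_uniq us andbT inE negb_or.
    apply/andP; split; first by apply: contraNneq zS => ->.
    by apply: contra zS; apply: ss.
  + by move=> t; rewrite inE => /orP[/eqP->|/ss H]; rewrite in_setU1 ?vS ?H orbT.
- have [s [ps ls us ss]] := IH x v xS vS; exists (rcons s z); split=> //.
  + by rewrite rcons_path ps ls eC.
  + by rewrite last_rcons.
  + rewrite -rcons_cons rcons_uniq us andbT inE negb_or.
    apply/andP; split; first by apply: contraNneq zS => ->.
    by apply: contra zS; apply: ss.
  + move=> t; rewrite mem_rcons inE in_setU1 => /orP[->//|/ss ->].
    by rewrite orbT.
have [s [ps ls us ss]] := IH x y xS yS; exists s; split=> // t /ss.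
by apply: setU1r.
Qed.

(** A subtree is enlarged until it covers [T]: connectedness gives an edge leaving it, and
    acyclicity allows the outer end only one neighbour inside. *)
Lemma tree_setT (r : T) : connected e -> acyclic e -> tree [set: T].
Proof.
move=> con acy.
suff H n : n < #|T| -> exists2 S, tree S & #|S| = n.+1.
  have T0 : 0 < #|T| by apply/card_gt0P; exists r.
  have [|S tS cS] := H #|T|.-1; first by rewrite prednK.
  suff <- : S = [set: T] by [].
  by apply/eqP; rewrite eqEcard subsetT cardsT cS prednK ?leqnn.
elim: n => [|n IH] nT; first by exists [set r]; [exact: tree_root | rewrite cards1].
have [S tS cS] := IH (ltnW nT).
have [x xS] : exists x, x \notin S.
  apply/existsP; apply: contraTT nT; rewrite negb_exists => /forallP H.
  rewrite -cS -leqNgt subset_leq_card //; apply/subsetP=> x _.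
  by move: (H x); rewrite negbK.
have [y yS] : exists y, y \in S by apply/card_gt0P; rewrite cS.
(* A walk from [y] inside [S] to [x] outside has to leave [S] along some edge. *)
have [z [w [zS wS ezw]]] : exists z w, [/\ z \notin S, w \in S & e z w].
  have /connectP[s ps lx] := con y x.
  elim: s y yS ps lx => [|t s IHs] y yS /=; first by move=> _ xy; rewrite xy yS in xS.
  move=> /andP[eyt ps] lx; have [tS'|tS'] := boolP (t \in S); first exact: IHs ps lx.
  by exists t, y; rewrite eC.
exists (z |: S); last by rewrite cardsU1 zS cS.
apply: (tree_attach (v := w)) => //; split=> // u uS.
apply/idP/eqP=> [ezu|-> //]; apply/eqP/negPn/negP=> uw.
(* A second neighbour [u] of [z] would close a cycle with a path from [u] to [w] inside [S]. *)
have [s [ps ls us ss]] := tree_path tS uS wS.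
have := acy (z :: u :: s); rewrite cons_uniq us andbT => /(_ _ _)/negP[].
- by rewrite inE negb_or; apply/andP; split; [apply: contraNneq zS => -> | apply: contra zS; apply: ss].
- by case: s ls {ps us ss} => //= uw'; rewrite uw' eqxx in uw.
by rewrite /= rcons_path ezu ps ls eC.
Qed.

(** * Trees on four vertices *)

(** The leaves would fill [S], so the neighbour of a leaf would be a leaf. *)
Lemma no_four_leaves S : tree S -> #|S| = 4 -> ~ four_leaves S.
Proof.
move=> tS cS [[|x s] [us s4 Ls]] //; have [v Lx] := Ls x (mem_head x s).
have sub : [set y in x :: s] \subset S.
  by apply/subsetP=> y; rewrite inE => /Ls[w []].
have eqS : [set y in x :: s] = S.
  by apply/eqP; rewrite eqEcard sub cS cardsE (card_uniqP us) s4.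
have [_ vS _] := Lx; move: vS; rewrite -eqS inE => /Ls[w Lv].
by apply: leaves_nonadjacent tS _ Lx Lv; rewrite cS.
Qed.

Lemma path_is_P4 c x y z : spider [set: T] c [:: x; y; z] [::] [::] -> is_P4 e.
Proof.
case=> U M Hc /= [Hx [Hy [Hz _]]] _.
have mem u : u \in [:: c; x; y; z] by rewrite -M inE.
have ix u : index u [:: c; x; y; z] < 4 by rewrite index_mem.
pose f u : 'I_4 := inord (index u [:: c; x; y; z]).
have cT : #|T| = 4 by rewrite -cardsT (eq_card M) (card_uniqP U).
exists f; split.
  apply: inj_card_bij; last by rewrite card_ord cT.
  move=> u v /(congr1 val); rewrite /= !inordK // => E.
  by rewrite -(nth_index c (mem u)) E nth_index.
move=> u v; rewrite /P4_adj /f !inordK //.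
move: U; rewrite /= !inE !negb_or !andbT.
case/and3P=> /and3P[cx cy cz] /andP[xy xz] yz.
have [xc yc zc] : [/\ x != c, y != c & z != c] by rewrite ![_ == c]eq_sym.
have [yx zx zy] : [/\ y != x, z != x & z != y] by rewrite ![_ == x]eq_sym [z == y]eq_sym.
have E := (eqxx, negbTE cx, negbTE cy, negbTE cz, negbTE xy, negbTE xz, negbTE yz,
  negbTE xc, negbTE yc, negbTE zc, negbTE yx, negbTE zx, negbTE zy).
by move: (mem u) (mem v); rewrite !inE => /or4P[] /eqP-> /or4P[] /eqP->;
  rewrite ?Hc ?Hx ?Hy ?Hz ?inE //= ?(inj_eq Some_inj) ?E.
Qed.

(** With four distinct vertex labels the edges take the three nonzero labels, so the rare label is
    0. As the star has only three leaves, it fails the invariant; hence the induction starts at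
    eight vertices. *)
Lemma star_balanced S c x y z :
  spider S c [:: x] [:: y] [:: z] -> exists l d, balanced S 1 d l.
Proof.
move=> sp; have [Lx /spider_rot sp1] := spider_leaf (p := [::]) sp.
have [Ly /spider_rot sp2] := spider_leaf (p := [::]) sp1.
have [Lz [_ M _ _ _]] := spider_leaf (p := [::]) sp2.
have Sc : S :\ x :\ y :\ z = [set c] by apply/setP=> u; rewrite M !inE.
have [[[xS _ _] [yS _ _]] [zS _ _]] := (Lx, Ly, Lz).
pose s := [:: (z, c); (y, c); (x, c)].
have gs : grows [set c] s.
  rewrite -Sc /= setD1K // setD1K //.
  by split; [|split; [|split]]; rewrite //; apply: leaf_attached.
have Es : grow [set c] s = S by rewrite -Sc /= setD1K // setD1K // setD1K.
have [|a||l bal] := @balanced_code c s 1 labs (false, false) gs.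
- by [].
- by case: a => [[] []].
- by rewrite /code /= eqxx.
by exists l, (false, false); rewrite -Es.
Qed.

Lemma tree4_balanced S :
  S = [set: T] -> tree S -> #|S| = 4 -> ~ is_P4 e -> exists l d, balanced S 1 d l.
Proof.
move=> ST tS cS nP4.
have [[c [p [q [r sp]]]]|] := spider_or_four_leaves tS; last first.
  by move/(no_four_leaves tS cS).
(* With [P_4] excluded no leg can be empty, so the three legs have one vertex each. *)
have path_case c' p' q' : ~ spider S c' p' q' [::].
  case/spider_path_end=> c1 [p1 sp1]; apply: nP4.
  have : size p1 = 3.
    by case: sp1 => U M _ _ _; move: (card_uniqP U); rewrite -(eq_card M) cS /= cats0; lia.
  case: p1 sp1 => [|x [|y [|z []]]] // sp1 _; apply: (@path_is_P4 c1 x y z).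
  by rewrite -ST.
have : size p + (size q + size r) = 3.
  case: sp => U M _ _ _; move: (card_uniqP U); rewrite -(eq_card M) cS /= !size_cat.
  by lia.
case: r sp => [/path_case //|z r] sp; case: q sp => [|y q] sp.
  by case: (path_case _ _ _ (spider_rot (spider_rot sp))).
case: p sp => [/spider_rot/path_case //|x p] sp.
case: r sp => [|? ?] sp; last by move=> /=; lia.
case: q sp => [|? ?] sp; last by move=> /=; lia.
case: p sp => [|? ?] sp; last by move=> /=; lia.
by move=> _; apply: star_balanced sp.
Qed.

End Graph.

(** * Passage to the Klein four-group *)

Definition klein (a : lab) : Klein4 := ((nat_of_bool a.1)%:R, (nat_of_bool a.2)%:R)%R.

Lemma klein_surj (b : Klein4) : exists a, b = klein a.
Proof.
case: b => x y; exists (x != 0%R, y != 0%R).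
by case: x y => [[|[|//]] ?] [[|[|//]] ?]; congr pair; apply: val_inj.
Qed.

Lemma klein_inj : injective klein.
Proof. by move=> [[] []] [[] []]. Qed.

Lemma kleinD a b : (klein a + klein b)%R = klein (addl a b).
Proof. by case: a b => [[] []] [[] []]; congr pair; apply: val_inj. Qed.

Lemma balanced_cordial (T : finType) (e : rel T) k d l :
  balanced e [set: T] k d l -> cordial e Klein4.
Proof.
move=> bal; exists (klein \o l).
have V a : fV (klein \o l) (klein a) = cV [set: T] l a.
  by apply: eq_card => x; rewrite !inE /= (inj_eq klein_inj).
have E a : fE e (klein \o l) (klein a) = cE e [set: T] l a.
  congr #|pred_of_set _|; apply/setP=> A.
  by apply/imset2P/imset2P=> -[x y _]; rewrite !inE /= ?kleinD ?(inj_eq klein_inj) => H ->;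
    exists x y; rewrite // !inE /= ?kleinD ?(inj_eq klein_inj).
move=> a1 a2; have [b1 ->] := klein_surj a1; have [b2 ->] := klein_surj a2.
rewrite !V !E; have [-> E1] := bal b1; have [-> E2] := bal b2.
split; first by rewrite distnn.
by move: E1 E2; case: (b1 == d); case: (b2 == d); lia.
Qed.

Theorem theorem5p1 (T : finType) (e : rel T) (k : nat) :
  is_tree e -> #|T| = 4 * k -> ~ is_P4 e -> cordial e Klein4.
Proof.
move=> [[eC eirr] con acy] cT nP4.
case: k cT => [|k] cT.
  have T0 (x : T) : False by have := fintype0 x; rewrite cT; apply.
  pose l (_ : T) : Klein4 := 0%R; exists l => a1 a2.
  have V a : fV l a = 0 by apply: eq_card0 => x; case: (T0 x).
  have E a : fE e l a = 0.
    by apply: eq_card0 => A; apply/negbTE/imset2P=> -[x]; case: (T0 x).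
  by rewrite !V !E.
have [r _] : exists r : T, r \in T by apply/card_gt0P; rewrite cT.
have tT := tree_setT eC r con acy.
(* Four vertices are treated apart from the induction. *)
case: k cT => [|k] cT; last first.
  have [|l [d [bal _]]] := @tree_balanced T e eC eirr k _ tT; first by rewrite cardsT.
  exact: balanced_cordial bal.
have [|l [d bal]] := tree4_balanced eC eirr erefl tT _ nP4; first by rewrite cardsT.
exact: balanced_cordial bal.
Qed.
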